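(* Assume the Riemann hypothesis. Let $a=e^{9/2}$, let $\Delta>0$ be a sufficiently small fixed number, and let $N:(0,\Delta)\to(0,\infty)$ be a function such that $$\int_2^{N(\delta)}P(x)\,dx=-\frac{a}{\delta}+\mathcal{O}(1),\qquad \delta\in(0,\Delta),$$ where $\mathcal{O}(1)$ stands for a continuous and bounded function of $\delta\in(0,\Delta)$. Then for every $k,l\in\mathbb{N}$, $$\int_{N\left(\frac{a\delta}{k}\right)}^{N\left(\frac{a\delta}{k+1}\right)}P(x)\,dx\sim\int_{N\left(\frac{a\delta}{l}\right)}^{N\left(\frac{a\delta}{l+1}\right)}P(x)\,dx,\qquad \delta\to0^+.$$
   Context: $\pi(x)$ is the prime-counting function, $\operatorname{li}(x)=\int_0^x \frac{dt}{\ln t}$ is the logarithmic integral (the integral is taken as a Cauchy principal value at $t=1$), and $P(x)=\pi(x)-\operatorname{li}(x)$ is the remainder. $\mathbb{N}=\{1,2,3,\dots\}$. Integrals are oriented: $\int_u^v=-\int_v^u$. The relation $A\sim B$ means that the ratio $A/B$ tends to $1$ in the stated limit (here $\delta\to0^+$ with $k,l$ fixed). *)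

(* Defs.v *)
From mathcomp Require Import all_boot all_order all_algebra.
From mathcomp Require Import all_classical all_reals all_analysis.
From mathcomp Require Import complex.

Set Implicit Arguments.
Unset Strict Implicit.
Unset Printing Implicit Defensive.

Import Order.TTheory GRing.Theory Num.Theory.
Import numFieldNormedType.Exports.

Local Open Scope classical_set_scope.
Local Open Scope ring_scope.
Local Open Scope complex_scope.

(* The real and imaginary parts are the real-valued [complex.Re], [complex.Im];
   R[i]^o carries the norm topology, and [derivable f s 1] over the scalar
   field R[i] is complex differentiability of f at s. *)

(* n^(-s) = exp (- s ln n), for n > 0 *)
Definition nat_cpow_opp (R : realType) (n : nat) (s : R[i]) : R[i]^o :=
  let r := expR (- (complex.Re s * ln n%:R)) in
  let t := complex.Im s * ln n%:R in
  (r * cos t) -i* (r * sin t).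

(* zeta is the analytic continuation to C \ {1} of the Dirichlet series
   \sum_(n >= 1) n^(-s), Re s > 1; its value at the pole s = 1 is arbitrary. *)
Definition is_riemann_zeta (R : realType) (zeta : R[i]^o -> R[i]^o) : Prop :=
  (forall s : R[i]^o, s != 1 -> derivable zeta s 1) /\
  (forall s : R[i]^o, 1 < complex.Re s ->
     series (fun n => nat_cpow_opp n.+1 s) @ \oo --> zeta s).

Definition riemann_hypothesis (R : realType) : Prop :=
  forall zeta : R[i]^o -> R[i]^o, is_riemann_zeta zeta ->
  forall s : R[i]^o, s != 1 -> zeta s = 0 ->
    (forall n : nat, s != - (n.+1.*2)%:R) ->
    complex.Re s = 1 / 2.

Definition prime_pi (R : realType) (x : R) : nat :=
  \sum_(p < (Num.truncn x).+1) prime p.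

(* Cauchy principal value at t = 1; for 0 < x < 1 the removed interval is
   eventually outside the domain.  At x = 1, where li diverges to -oo, the
   value is junk. *)
Definition li (R : realType) (x : R) : R :=
  lim ((\int[@lebesgue_measure R]_(t in `[0, x] `\` `]1 - e, 1 + e[) (ln t)^-1)
         @[e --> (0 : R)^'+]).

Definition remainder (R : realType) (x : R) : R := (prime_pi x)%:R - li x.

(* Lebesgue, not Riemann: [remainder] has a logarithmic singularity at 1. *)
Definition oriented_int (R : realType) (u v : R) (f : R -> R) : R :=
  if u <= v then \int[@lebesgue_measure R]_(x in `[u, v]) f x
  else - \int[@lebesgue_measure R]_(x in `[v, u]) f x.

(* A ~ B as delta -> 0+ : the ratio tends to 1.  Division by 0 being 0, this
   forces B to be nonzero near 0+. *)
Definition equiv_at_right0 (R : realType) (A B : R -> R) : Prop :=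
  A d / B d @[d --> (0 : R)^'+] --> (1 : R).

(* Main.v *)
(** The integral of [P] from [N(a d/k)] to [N(a d/(k+1))] is the difference of
two integrals from [2], hence [k/d - (k+1)/d + O(1) = - 1/d + O(1)] for every
[k], so any two of them have ratio tending to [1].  Splitting the integral needs
[P] integrable across the singularity of [li] at [1].  There, up to sign, [li x]
differs by a constant from the integral of [|1/ln t|] between [x] and an
endpoint on the same side of [1], and Tonelli turns the integral over [x] of
these into that of [|t - 1| / |ln t|], which is bounded by [max(1, t)]. *)

Require Import Defs.
From mathcomp Require Import all_boot all_order all_algebra.
From mathcomp Require Import all_classical all_reals all_analysis.
From mathcomp Require Import measurable_realfun ring lra.
Import Order.TTheory GRing.Theory Num.Theory.
Import numFieldNormedType.Exports.
Local Open Scope classical_set_scope.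
Local Open Scope ring_scope.

(** * Measurability of [(ln t)^-1] and its size near [t = 1] *)

Lemma measurable_invr (R : realType) : measurable_fun setT (@GRing.inv R).
Proof.
(* This is [x / |x|^2], both sides being 0 at 0; real powers are known to be measurable. *)
have -> : @GRing.inv R = fun x => x * (`|x| `^ (-1)) ^+ 2.
  apply/funext => x; rewrite powR_inv1 ?normr_ge0//.
  have [->|x0] := eqVneq x 0; first by rewrite invr0 mul0r.
  by rewrite -normfV real_normK ?num_real// expr2 mulrA divff// mul1r.
apply: measurable_funM => //; apply: measurable_funX.
exact: (measurableT_comp (measurable_powR (-1)) (@normr_measurable R setT)).
Qed.

Lemma measurable_invr_ln (R : realType) :
  measurable_fun setT (fun t : R => (ln t)^-1).
Proof. exact: measurableT_comp (@measurable_invr R) (@measurable_ln R). Qed.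

(** From [1 - t^-1 <= ln t <= t - 1], [|t - 1|] is at most [|ln t|] for [0 < t < 1] and at most
    [t * |ln t|] for [t > 1]. At [t = 0] the conventions [ln 0 = 0] and [0^-1 = 0] make the product
    0. *)
Lemma invr_ln_le (R : realType) (X t : R) : 1 <= X -> 0 <= t <= X ->
  `|(ln t)^-1| * `|t - 1| <= X.
Proof.
move=> X1 /andP[t0 tX].
have [->|t0'] := eqVneq t 0.
  by rewrite ln0// invr0 normr0 mul0r; lra.
have [->|t1] := eqVneq t 1; first by rewrite subrr normr0 mulr0; lra.
have tp : 0 < t by rewrite lt_neqAle eq_sym t0'.
have l1 : ln t <= t - 1.
  by have := @le_ln1Dx R (t - 1); rewrite subrKC; apply; lra.
have l2 : 1 - t^-1 <= ln t.
  have : -1 < t^-1 - 1 by have := invr_gt0 t; rewrite tp => h; lra.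
  by move=> /le_ln1Dx; rewrite subrKC lnV//; lra.
have lt0 : ln t != 0 by rewrite ln_eq0.
rewrite normfV mulrC ler_pdivrMr ?normr_gt0//.
have [t1'|t1'|tt] := ltgtP t 1.
- rewrite (ltr0_norm (_ : t - 1 < 0)) ?subr_lt0//.
  rewrite ler0_norm; last lra.
  apply: (@le_trans _ _ (1 * - ln t)); first lra.
  by apply: ler_wpM2r; lra.
- have l3 : 0 < ln t by rewrite ln_gt0.
  rewrite !gtr0_norm ?subr_gt0//.
  apply: (@le_trans _ _ (t * ln t)); last by rewrite ler_pM2r.
  have -> : t - 1 = t * (1 - t^-1) by rewrite mulrBr divff// mulr1.
  by rewrite ler_pM2l.
- by rewrite tt eqxx in t1.
Qed.

(** * The kernel [|1 / ln t|] and Tonelli's theorem *)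

Section log_kernel.
Variable R : realType.
Implicit Types x t X : R.
Local Notation mu := (@lebesgue_measure R).

(* Restricting [x] to one side of [1] keeps the singularity out of every row:
   row [x] is [0, x] if [x < 1] and ]x, X] if [x > 1]. *)
Definition kernel_dom X x t : bool :=
  [&& 0 <= t, t <= x & x < 1] || [&& 1 < x, x < t & t <= X].

Definition log_kernel X x t : R :=
  if kernel_dom X x t then `|(ln t)^-1| else 0.

Definition log_kernel_int X x : \bar R := (\int[mu]_t (log_kernel X x t)%:E)%E.

Lemma measurable_log_kernel X :
  measurable_fun setT (fun p : R * R => (log_kernel X p.1 p.2)%:E).
Proof.
apply/measurable_EFinP; apply: measurable_fun_ifT.
- have := @measurable_fst _ _ R R; have := @measurable_snd _ _ R R => m2 m1.
  by apply: measurable_or; apply: measurable_and; try apply: measurable_and;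
    (apply: measurable_fun_ler || apply: measurable_fun_ltr).
- apply: measurableT_comp => //.
  exact: (measurableT_comp (@measurable_invr_ln R) measurable_snd).
- exact: measurable_cst.
Qed.

Lemma log_kernel_ge0 X x t : 0 <= log_kernel X x t.
Proof. by rewrite /log_kernel; case: ifP. Qed.

(** For fixed [t] the admissible [x] lie between [t] and 1, and there are none unless [0 <= t <= X].
    The column is thus at most [|(ln t)^-1| * |t - 1|], which [invr_ln_le] bounds by [X]. *)
Lemma log_kernel_column X t : 1 <= X ->
  (\int[mu]_x (log_kernel X x t)%:E <= (X * \1_(`[0, X]) t)%:E)%E.
Proof.
move=> X1; rewrite indicE.
have [tX|tX] := boolP (t \in `[0, X]); last first.
  rewrite integral0_eq; first by rewrite lee_fin mulr_ge0 //; lra.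
  move=> x _; rewrite /log_kernel ifF//.
  apply/negP => /orP[] /and3P[h1 h2 h3]; move/negP: tX; apply;
    rewrite in_itv/=; lra.
rewrite mem_set// mulr1.
move: (tX); rewrite in_itv/= => tX'.
pose I := `[Num.min t 1, Num.max t 1]%classic.
apply: (@le_trans _ _ (\int[mu]_x ((`|(ln t)^-1|)%:E * (\1_I x)%:E))%E).
  apply: ge0_le_integral => //.
  - by move=> x _; rewrite lee_fin log_kernel_ge0.
  - exact: (measurableT_comp (measurable_log_kernel X) (measurable_pair2 t)).
  - apply/measurable_EFinP/measurable_funM => //.
    by apply: measurable_indic; exact: measurable_itv.
  - move=> x _; rewrite -EFinM lee_fin /log_kernel indicE; case: ifPn => [h|_].
      rewrite mem_set ?mulr1// /I set_itvE/= ge_min le_max.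
      by case/orP: h => /and3P[h1 h2 h3]; apply/andP; split; apply/orP; lra.
    by rewrite mulr_ge0.
rewrite ge0_integralZl//; last first.
  by apply/measurable_EFinP; apply: measurable_indic; exact: measurable_itv.
rewrite integral_indic//; last exact: measurable_itv.
rewrite setIT.
rewrite [Z in (_ * Z)%E](lebesgue_measure_itv `[Num.min t 1, Num.max t 1])/=.
rewrite lte_fin.
case: ifPn => h; last by rewrite mule0 lee_fin; lra.
rewrite -EFinD -EFinM lee_fin.
apply: le_trans (invr_ln_le _ _ _ X1 tX').
rewrite ler_wpM2l//.
by case: (leP t 1) => h1; [rewrite ler0_norm|rewrite ger0_norm]; lra.
Qed.

(** By Tonelli the integral of the rows is that of the columns, at most the integral of [X] over
    [[0, X]]. *)
Lemma log_kernel_int_integrable X : 1 <= X ->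
  mu.-integrable setT (log_kernel_int X).
Proof.
move=> X1; apply/integrableP; split.
  apply: (@measurable_fun_fubini_tonelli_F _ _ _ _ _ mu
    (fun p : R * R => (log_kernel X p.1 p.2)%:E)).
    exact: measurable_log_kernel.
  by move=> p; rewrite lee_fin log_kernel_ge0.
under eq_integral => x _.
  rewrite gee0_abs; last first.
    by apply: integral_ge0 => t _; rewrite lee_fin log_kernel_ge0.
  over.
rewrite (@fubini_tonelli _ _ _ _ _ mu mu
    (fun p : R * R => (log_kernel X p.1 p.2)%:E));
  [|exact: measurable_log_kernel|by move=> p; rewrite lee_fin log_kernel_ge0].
apply: (@le_lt_trans _ _ (\int[mu]_t (X%:E * (\1_(`[0, X]) t)%:E))%E).
  apply: ge0_le_integral => //.
  - by move=> t _; apply: integral_ge0 => x _; rewrite lee_fin log_kernel_ge0.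
  - apply: (@measurable_fun_fubini_tonelli_G _ _ _ _ _ mu
      (fun p : R * R => (log_kernel X p.1 p.2)%:E)).
      exact: measurable_log_kernel.
    by move=> p; rewrite lee_fin log_kernel_ge0.
  - apply/measurable_EFinP/measurable_funM => //.
  - by move=> t _; rewrite -EFinM; exact: log_kernel_column.
rewrite ge0_integralZl//; last 2 first.
- by apply/measurable_EFinP; apply: measurable_indic; exact: measurable_itv.
- by rewrite lee_fin; lra.
rewrite integral_indic//.
rewrite setIT [Z in (_ * Z)%E](lebesgue_measure_itv `[0, X])/= lte_fin.
rewrite ifT; last lra.
by rewrite -EFinD -EFinM ltry.
Qed.

End log_kernel.

(** * Integrability of [li], [prime_pi] and [remainder] *)

Section li_integrable.
Variable R : realType.
Implicit Types x t X : R.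
Local Notation mu := (@lebesgue_measure R).

(** At distance at least [e] from 1, [invr_ln_le] bounds [|(ln t)^-1|] by [X / e]. This serves the
    truncated integrals defining [li]. *)
Lemma invr_ln_integrable X e (D : set R) : 1 <= X -> 0 < e -> measurable D ->
  D `<=` `[0, X] -> (forall t, D t -> e <= `|t - 1|) ->
  mu.-integrable D (EFin \o (fun t => (ln t)^-1)).
Proof.
move=> X1 e0 mD DX De; apply: measurable_bounded_integrable => //.
- apply: (@le_lt_trans _ _ (mu `[0, X])).
    by apply: le_measure => //; rewrite inE//; exact: measurable_itv.
  rewrite lebesgue_measure_itv/=.
    by case: ifP => _; rewrite ?ltry// -EFinD ltry.
- by apply: measurable_funTS; exact: measurable_invr_ln.
- exists (X / e); split; first by rewrite num_real.
  move=> y Xy t Dt /=; apply: le_trans (ltW Xy).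
  rewrite ler_pdivlMr//.
  have tX : 0 <= t <= X by have := DX _ Dt; rewrite /= in_itv.
  apply: le_trans (invr_ln_le _ _ _ X1 tX).
  by rewrite ler_wpM2l// De.
Qed.

Lemma log_kernel_int_lt1 X x : 0 <= x < 1 ->
  log_kernel_int R X x = (\int[mu]_(t in `[0%R, x]) `|(ln t)^-1|%:E)%E.
Proof.
move=> x01; rewrite [RHS]integral_mkcond; apply: eq_integral => t _.
rewrite patchE/= /log_kernel /kernel_dom mem_setE in_itv/=.
rewrite (_ : 1 < x = false) /=; last by apply/negbTE; rewrite -leNgt; lra.
by rewrite (_ : x < 1) ?andbT ?orbF; [case: ifP|lra].
Qed.

Lemma log_kernel_int_gt1 X x : 1 < x ->
  log_kernel_int R X x = (\int[mu]_(t in `]x, X]) `|(ln t)^-1|%:E)%E.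
Proof.
move=> x1; rewrite [RHS]integral_mkcond; apply: eq_integral => t _.
rewrite patchE/= /log_kernel /kernel_dom mem_setE in_itv/= x1.
rewrite (_ : x < 1 = false) ?andbF/=; first by case: ifP.
by apply/negbTE; rewrite -leNgt ltW.
Qed.

(** Once [e < 1 - x], the removed interval misses [[0, x]] and the truncated integral no longer
    depends on [e]. The minus sign comes from [ln t <= 0]. *)
Lemma li_lt1 X x : 0 <= x < 1 -> li x = - fine (log_kernel_int R X x).
Proof.
move=> x01; rewrite log_kernel_int_lt1// -fineN -integral_ge0N//.
apply: lim_near_cst => //; near=> e.
have e0 : 0 < e by near: e; exact: nbhs_right_gt.
have e1 : e < 1 - x by near: e; apply: nbhs_right_lt; lra.
rewrite (_ : _ `\` _ = `[0, x]%classic); last first.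
  apply/seteqP; split => [t []//|t tx]; split=> //.
  by move: tx; rewrite /= !in_itv/=; lra.
congr fine; apply: eq_integral => t; rewrite inE/= in_itv/= => tx.
rewrite ler0_norm ?opprK//.
by rewrite invr_le0; apply: ln_le0; lra.
Unshelve. all: by end_near. Qed.

(* If the principal value at [1] failed to exist, [li] would be the junk value
   of [lim] throughout ]1, X]; allowing [b = false] makes it unnecessary to
   prove that it exists. *)
Lemma li_gt1 X : 1 < X -> exists (c : R) (b : bool), forall x, 1 < x <= X ->
  li x = c - b%:R * fine (log_kernel_int R X x).
Proof.
move=> X1.
pose F x e := \int[mu]_(t in `[0, x] `\` `]1 - e, 1 + e[) (ln t)^-1.
(* For [e < x - 1] the truncated integrals up to [x] and up to [X] differ by the integral over []x,
   X]], which is free of [e]; they converge together or not at all. *)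
have FE x : 1 < x <= X ->
    \forall e \near 0^'+, F x e = F X e - fine (log_kernel_int R X x).
  move=> x1X; near=> e.
  have e0 : 0 < e by near: e; exact: nbhs_right_gt.
  have e1 : e < x - 1 by near: e; apply: nbhs_right_lt; lra.
  have mx : measurable (`[0, x] `\` `]1 - e, 1 + e[ : set R).
    by apply: measurableD; exact: measurable_itv.
  have XE : `[0, X] `\` `]1 - e, 1 + e[ =
            (`[0, x] `\` `]1 - e, 1 + e[) `|` `]x, X]%classic.
    apply/seteqP; split => [t [] | t [[]|]]; rewrite /= !in_itv/=.
    - move=> tX te; have [tx|tx] := leP t x; [left|right]; last lra.
      by split => //; lra.
    - by move=> tX te; split => //; lra.
    - by move=> tX; split; lra.
  rewrite /F XE Rintegral_setU//; last 2 first.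
  - rewrite -XE; apply: (@invr_ln_integrable X e); [lra|by []|..].
    + by apply: measurableD; exact: measurable_itv.
    + by move=> t [].
    + move=> t [] _ /=; rewrite in_itv/= leNgt ltr_distl => h.
      by apply/negP => /h.
  - apply/disj_setPS => t [[]]; rewrite /= !in_itv/=; lra.
  apply/eqP; rewrite eq_sym subr_eq; apply/eqP; congr (_ + _).
  rewrite log_kernel_int_gt1; last lra.
  congr fine; apply: eq_integral => t; rewrite inE/= in_itv/= => tx.
  rewrite ger0_norm// invr_ge0; apply: ln_ge0; lra.
have [/cvg_ex[l Fl]|ncv] := pselect (cvg (F X e @[e --> 0^'+])).
  exists l, true => x x1X; rewrite mul1r; apply: cvg_lim => //.
  apply: (@cvg_trans _ (F X e - fine (log_kernel_int R X x) @[e --> 0^'+])).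
    apply: near_eq_cvg; near=> e; apply/esym; near: e; exact: FE.
  by apply: cvgB => //; exact: cvg_cst.
(* By [FE] a limit at [x] would give one at [X], so for every such [x] the value of [lim] is its
   default [point]. *)
exists point, false => x x1X; rewrite mul0r subr0; apply: dvgP.
move=> /cvg_ex[l Fl]; apply: ncv; apply/cvg_ex.
exists (l + fine (log_kernel_int R X x)).
apply: (@cvg_trans _ (F x e + fine (log_kernel_int R X x) @[e --> 0^'+])).
  apply: near_eq_cvg; near=> e; rewrite (near (FE x x1X) e)//.
  by rewrite subrK.
by apply: cvgD => //; exact: cvg_cst.
Unshelve. all: by end_near. Qed.

(** The formulas for [li] on the two sides of 1 give both its measurability and its domination by a
    constant plus [log_kernel_int]. *)
Lemma li_integrable X : mu.-integrable `[0, X] (EFin \o @li R).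
Proof.
wlog X1 : X / 1 < X.
  move=> H; have /H : 1 < Num.max X 2 by rewrite lt_max; apply/orP; right; lra.
  apply: integrableS; [exact: measurable_itv|exact: measurable_itv|].
  by move=> t; rewrite /= !in_itv/= le_max => /andP[-> ->].
have [c [b Hc]] := li_gt1 X X1.
pose g x := fine (log_kernel_int R X x).
have kint := log_kernel_int_integrable R X (ltW X1).
have mg : measurable_fun setT g.
  by apply: measurableT_comp => //; case/integrableP: kint.
pose h x := if x < 1 then - g x else if x <= 1 then li 1 else c - b%:R * g x.
have lih x : 0 <= x <= X -> li x = h x.
  move=> xX; rewrite /h; have [x1|x1|->//] := ltgtP x 1.
  - by apply: li_lt1; lra.
  - by apply: Hc; lra.
have mh : measurable_fun setT h.
  apply: measurable_fun_ifT.
  - exact: measurable_fun_ltr.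
  - exact: measurableT_comp.
  - apply: measurable_fun_ifT => //; first exact: measurable_fun_ler.
    by apply: measurable_funB => //; apply: measurable_funM.
(* [C] covers the value at 1 and the additive constant [c]; what remains of [h] is at most [|g|]. *)
pose C := `|li 1 : R| + `|c|.
have C0 : 0 <= C by rewrite addr_ge0.
have key : mu.-integrable `[0, X] (fun x => C%:E + `|log_kernel_int R X x|)%E.
  apply: integrableD => //.
    apply/integrableP; split => //=.
    rewrite integral_cst//= lebesgue_measure_itv/= lte_fin ifT; last lra.
    by rewrite -EFinD -EFinM ltry.
  by apply: integrable_abse; apply: integrableS kint.
apply: le_integrable key.
- exact: measurable_itv.
- apply/measurable_EFinP.
  apply: (eq_measurable_fun h).
    by move=> x; rewrite inE/= in_itv/= => /lih.
  exact: measurable_funTS.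
- move=> x; rewrite /= in_itv/= => /lih ->.
  rewrite [leRHS]gee0_abs; last by rewrite adde_ge0.
  apply: (@le_trans _ _ (C%:E + `|g x|%:E)%E).
    rewrite -EFinD lee_fin /h.
    have n1 := normr_ge0 (li 1 : R); have n2 := normr_ge0 c.
    have n3 := normr_ge0 (g x).
    rewrite /C; case: ifP => _; first by rewrite normrN; lra.
    case: ifP => _; first lra.
    apply: le_trans (ler_normB _ _) _; rewrite normrM.
    by case: b {Hc h lih mh} => /=; rewrite ?normr1 ?normr0; lra.
  (* [fine] sends infinite values to 0, so the bound also holds where the row integral is
     infinite. *)
  apply: leeD => //; rewrite /g; case: (log_kernel_int R X x) => [r| |] //=.
  + by rewrite normr0 leey.
  + by rewrite normr0 leey.
Qed.

(** [prime_pi] is nondecreasing, hence measurable, and bounded on [[0, X]] by its value at [X]. *)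
Lemma prime_pi_integrable X :
  mu.-integrable `[0, X] (EFin \o (fun x => (prime_pi x)%:R : R)).
Proof.
have homo_pi : {homo @prime_pi R : x y / x <= y >-> (x <= y)%N}.
  move=> x y xy; rewrite /prime_pi.
  rewrite -(big_mkord xpredT (fun i => nat_of_bool (prime i))).
  rewrite -(big_mkord xpredT (fun i => nat_of_bool (prime i))).
  rewrite (@big_cat_nat _ _ _ (Num.trunc x).+1 0 (Num.trunc y).+1)//=.
    exact: leq_addr.
  by rewrite ltnS le_truncn.
apply: measurable_bounded_integrable.
- exact: measurable_itv.
- rewrite [Z in (Z < _)%E](lebesgue_measure_itv `[0, X])/=.
  by case: ifP => _; rewrite ?ltry// -EFinD ltry.
- apply: nondecreasing_measurable; first exact: measurable_itv.
  by move=> x y xy; rewrite ler_nat homo_pi.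
- exists (prime_pi X)%:R; split; first by rewrite num_real.
  move=> y Xy x; rewrite /= in_itv/= => /andP[x0 xX].
  by rewrite ger0_norm// (le_trans _ (ltW Xy))// ler_nat homo_pi.
Qed.

Lemma remainder_integrable X : mu.-integrable `[0, X] (EFin \o @remainder R).
Proof.
have : mu.-integrable `[0, X]
    ((EFin \o (fun x => (prime_pi x)%:R : R)) \- (EFin \o @li R))%E.
  by apply: integrableB; [exact: measurable_itv|exact: prime_pi_integrable|
    exact: li_integrable].
by apply: eq_integrable; [exact: measurable_itv|move=> x _; rewrite /= -EFinD].
Qed.

End li_integrable.

(** * Additivity of oriented integrals *)

Section oriented_integrals.
Variable R : realType.
Local Notation mu := (@lebesgue_measure R).

Lemma Rintegral_itv_cat (f : R -> R) (u v : R) : 0 <= u <= v ->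
  mu.-integrable `[0, v] (EFin \o f) ->
  \int[mu]_(x in `[0, v]) f x =
  \int[mu]_(x in `[0, u]) f x + \int[mu]_(x in `[u, v]) f x.
Proof.
move=> /andP[u0 uv] fi.
have fuv : mu.-integrable `]u, v] (EFin \o f).
  apply: integrableS fi; [exact: measurable_itv|exact: measurable_itv|].
  by move=> t; rewrite /= !in_itv/=; lra.
rewrite -(Rintegral_itv_obnd_cbnd fuv) -(@Rintegral_itvB _ _ _ _ u fi).
- by rewrite addrC subrK.
- by rewrite bnd_simp.
- by rewrite bnd_simp.
Qed.

(** One formula for both orientations, with the integral from 0 as primitive; later arguments need
    not compare the values of [N]. *)
Lemma oriented_intE (f : R -> R) (u v : R) : 0 <= u -> 0 <= v ->
  (forall X, mu.-integrable `[0, X] (EFin \o f)) ->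
  oriented_int u v f =
  \int[mu]_(x in `[0, v]) f x - \int[mu]_(x in `[0, u]) f x.
Proof.
move=> u0 v0 fi; rewrite /oriented_int; case: ifPn => uv.
  by rewrite (@Rintegral_itv_cat f u v) ?u0 ?uv// addrC addKr.
rewrite -ltNge in uv.
by rewrite (@Rintegral_itv_cat f v u) ?v0 ?ltW// opprD addNKr.
Qed.

Lemma oriented_int_base (f : R -> R) (w u v : R) :
  0 <= w -> 0 <= u -> 0 <= v ->
  (forall X, mu.-integrable `[0, X] (EFin \o f)) ->
  oriented_int u v f = oriented_int w v f - oriented_int w u f.
Proof. by move=> w0 u0 v0 fi; rewrite !oriented_intE//; lra. Qed.

End oriented_integrals.

(** * Functions with a simple pole at [0+] *)

Lemma cvg_mul_bounded_right0 (R : realType) (e : R -> R) (C : R) :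
  (\forall d \near 0^'+, `|e d| <= C) -> d * e d @[d --> 0^'+] --> (0 : R).
Proof.
move=> eC; apply: (@squeeze_cvgr _ _ _ _ (fun d => - (d * C)) (fun d => d * C)).
- near=> d.
  have d0 : 0 < d by near: d; exact: nbhs_right_gt.
  have : `|e d| <= C by near: d.
  by rewrite ler_norml -mulrN !ler_pM2l.
- rewrite -[X in _ --> X]oppr0; apply: cvgN; rewrite -[X in _ --> X](mul0r C).
  by apply: cvgM; [exact: cvg_at_right_filter|exact: cvg_cst].
- rewrite -[X in _ --> X](mul0r C).
  by apply: cvgM; [exact: cvg_at_right_filter|exact: cvg_cst].
Unshelve. all: by end_near. Qed.

(** The pole dominates the bounded error: [d * A d] and [d * B d] both tend to -1, so their quotient
    tends to 1. *)
Lemma equiv_at_right0_pole (R : realType) (A B : R -> R) (C : R) :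
  (\forall d \near 0^'+, `|A d + d^-1| <= C) ->
  (\forall d \near 0^'+, `|B d + d^-1| <= C) ->
  equiv_at_right0 A B.
Proof.
move=> AC BC; rewrite /equiv_at_right0.
have scaled (G : R -> R) : (\forall d \near 0^'+, `|G d + d^-1| <= C) ->
    d * G d @[d --> 0^'+] --> (- 1 : R).
  move=> /cvg_mul_bounded_right0 h.
  apply: (@cvg_trans _ (d * (G d + d^-1) - 1 @[d --> 0^'+])).
    apply: near_eq_cvg; near=> d.
    have d0 : 0 < d by near: d; exact: nbhs_right_gt.
    by rewrite mulrDr divff ?gt_eqF// addrK.
  by have := cvgB h (cvg_cst (1 : R)); rewrite sub0r; exact.
have -> : (1 : R) = - 1 / - 1 by rewrite divff// oppr_eq0.
(* Cancelling [d] is valid even where [B d = 0], as inversion is multiplicative with [0^-1 = 0]. *)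
apply: (@cvg_trans _ (d * A d / (d * B d) @[d --> 0^'+])).
  apply: near_eq_cvg; near=> d.
  have d0 : d != 0 by rewrite gt_eqF//; near: d; exact: nbhs_right_gt.
  by rewrite invfM mulrACA divff// mul1r.
apply: cvgM; first exact: scaled.
by apply: cvgV; [rewrite oppr_eq0|exact: scaled].
Unshelve. all: by end_near. Qed.

(** * Integrals of the remainder between successive values of [N] *)

Theorem corollary3 (R : realType) :
  riemann_hypothesis R ->
  let a : R := expR (9 / 2) in
  exists2 Delta0 : R, 0 < Delta0 &
  forall Delta : R, 0 < Delta < Delta0 ->
  forall N : R -> R,
    (forall d : R, 0 < d < Delta -> 0 < N d) ->
    (exists E : R -> R,
       [/\ {within `]0, Delta[, continuous E},
           exists M : R, forall d : R, 0 < d < Delta -> `|E d| <= M &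
           forall d : R, 0 < d < Delta ->
             oriented_int 2 (N d) (@remainder R) = - (a / d) + E d]) ->
  forall k l : nat, (0 < k)%N -> (0 < l)%N ->
    equiv_at_right0
      (fun d => oriented_int (N (a * d / k%:R)) (N (a * d / k.+1%:R))
                  (@remainder R))
      (fun d => oriented_int (N (a * d / l%:R)) (N (a * d / l.+1%:R))
                  (@remainder R)).
Proof.
move=> _ a; exists 1 => // Delta /andP[Delta0 _] N N0 [E [_ [M EM] NE]].
have a0 : 0 < a by exact: expR_gt0.
(* For [0 < d < Delta * n / a] the argument [a * d / n] lies where the expansion is assumed. *)
have arg_dom n : (0 < n)%N -> \forall d \near 0^'+, 0 < a * d / n%:R < Delta.
  move=> n0; have nR : (0 : R) < n%:R by rewrite ltr0n.
  near=> d.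
  have d0 : 0 < d by near: d; exact: nbhs_right_gt.
  rewrite divr_gt0 ?mulr_gt0//= ltr_pdivrMr// mulrC -ltr_pdivlMr//.
  by near: d; apply: nbhs_right_lt; rewrite divr_gt0 ?mulr_gt0.
(* At [a * d / n] the polar term is [n / d], so the terms for [k] and [k.+1] leave [- d^-1]. Two
   errors of size at most [M] remain, whence the bound [M + M], the same for every [k]. *)
have pole k : (0 < k)%N -> \forall d \near 0^'+,
    `|oriented_int (N (a * d / k%:R)) (N (a * d / k.+1%:R)) (@remainder R)
      + d^-1| <= M + M.
  move=> k0; near=> d.
  have d0 : 0 < d by near: d; exact: nbhs_right_gt.
  have u_dom : 0 < a * d / k%:R < Delta by near: d; exact: arg_dom.
  have v_dom : 0 < a * d / k.+1%:R < Delta by near: d; exact: arg_dom.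
  have quot n : (0 < n)%N -> a / (a * d / n%:R) = n%:R / d.
    by move=> n0; field; rewrite pnatr_eq0 -lt0n n0 !gt_eqF.
  rewrite (@oriented_int_base _ _ 2)//;
    [|by apply/ltW/N0|by apply/ltW/N0|exact: remainder_integrable].
  rewrite !NE// !quot//.
  rewrite (_ : _ + _ = E (a * d / k.+1%:R) - E (a * d / k%:R)); last first.
    by rewrite -natr1; field; rewrite gt_eqF.
  by apply: le_trans (ler_normB _ _) _; apply: lerD; exact: EM.
by move=> k l k0 l0; apply: (@equiv_at_right0_pole _ _ _ (M + M)); exact: pole.
Unshelve. all: by end_near. Qed.
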